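(* Assume the standing assumptions. Suppose that $\sigma$ is a stopping time (with respect to an admissible filtration) such that $\mathbf P(\sigma>0)>0$, $\mathbf P(S_\sigma\le0)=1$ and $\mathbf E\sigma<\infty$, and such that $$\lim_{x\to\infty}\frac{\mathbf P(M_\sigma>x)}{\overline F(x)}=\mathbf E\sigma.$$ Then $F\in\mathcal S^*$.
   Context: Standing assumptions: $\{\xi_n\}_{n\ge1}$ are i.i.d. real random variables with common distribution function $F$ and finite mean $\mathbf E\xi_1=-m<0$. $F$ is long-tailed: $\overline F(x):=1-F(x)>0$ for all $x$, and $\overline F(x-c)/\overline F(x)\to1$ as $x\to\infty$ for every fixed $c>0$. Notation: $S_0=0$ and $S_n=\sum_{i=1}^n\xi_i$; $M_\sigma=\max_{0\le i\le\sigma}S_i$. Admissible filtration: a stopping time $\sigma$, with values in $\{0,1,\dots\}\cup\{\infty\}$, is taken with respect to a filtration $\{\mathcal F_n\}_{n\ge0}$ such that for each $n$ the variable $\xi_n$ is $\mathcal F_n$-measurable and $\xi_{n+1}$ is independent of $\mathcal F_n$. The class $\mathcal S^*$: a distribution function $G$ on $\mathbb R$ belongs to $\mathcal S^*$ iff $\overline G(x)>0$ for all $x$ and $$\int_0^x\overline G(x-y)\overline G(y)\,dy\sim 2m_{G^+}\overline G(x)\quad(x\to\infty),$$ where $m_{G^+}=\int_0^\infty\overline G(t)\,dt$. *)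

(* Defs.v *)
From HB Require Import structures.
From mathcomp Require Import all_boot all_order all_algebra.
From mathcomp Require Import all_classical all_reals all_analysis.
Set Implicit Arguments. Unset Strict Implicit. Unset Printing Implicit Defensive.
Import Order.TTheory GRing.Theory Num.Theory.
Import numFieldNormedType.Exports.
Local Open Scope classical_set_scope.
Local Open Scope ring_scope.

(* Partial sums S_n = xi_1 + ... + xi_n, S_0 = 0 (xi 0 is unused). *)
Definition Ssum {T : Type} {R : realType} (xi : nat -> T -> R) (n : nat) (w : T) : R :=
  \sum_(1 <= i < n.+1) xi i w.

(* stopping times take values in nat ∪ {∞}; None encodes ∞ *)
Definition Msigma {T : Type} {R : realType} (xi : nat -> T -> R)
    (sigma : T -> option nat) (w : T) : \bar R :=
  match sigma w with
  | Some n => ((\big[Num.max/0]_(0 <= i < n.+1) Ssum xi i w))%:E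
  | None => ereal_sup (range (fun i => (Ssum xi i w)%:E))
  end.

Definition sigma_ext {T : Type} {R : realType} (sigma : T -> option nat) (w : T) : \bar R :=
  match sigma w with Some n => (n%:R)%:E | None => +oo%E end.

Definition tail {R : realType} (G : R -> R) (x : R) : R := 1 - G x.

Definition long_tailed {R : realType} (F : R -> R) : Prop :=
  (forall x, 0 < tail F x) /\
  (forall c : R, 0 < c -> (fun x => tail F (x - c) / tail F x) x @[x --> +oo] --> (1 : R)).

Definition mplus {R : realType} (G : R -> R) : \bar R :=
  (\int[@lebesgue_measure R]_(t in `[0%R, +oo[) (tail G t)%:E)%E.

Definition tailconv {R : realType} (G : R -> R) (x : R) : R :=
  Rintegral (@lebesgue_measure R) `[(0:R), x] (fun y => tail G (x - y) * tail G y).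

Definition Sstar {R : realType} (G : R -> R) : Prop :=
  (forall x, 0 < tail G x) /\
  (mplus G < +oo)%E /\
  (fun x => tailconv G x / (2 * fine (mplus G) * tail G x)) x @[x --> +oo] --> (1 : R).

Definition iid_indep {R : realType} {d : measure_display} {T : measurableType d}
    (P : probability T R) (xi : nat -> T -> R) : Prop :=
  forall (s : seq nat) (B : nat -> set R),
    uniq s -> all (fun i => 0 < i)%N s -> (forall i, measurable (B i)) ->
    P (\bigcap_(i in [set` s]) (xi i @^-1` B i)) =
    (\prod_(i <- s) P (xi i @^-1` B i))%E.

Definition admissible {R : realType} {d : measure_display} {T : measurableType d}
    (P : probability T R) (xi : nat -> T -> R) (Fn : nat -> set (set T)) : Prop :=
  (forall n, sigma_algebra setT (Fn n)) /\
  (forall n, Fn n `<=` measurable) /\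
  (forall n m, (n <= m)%N -> Fn n `<=` Fn m) /\
  (forall n B, (1 <= n)%N -> measurable B -> Fn n (xi n @^-1` B)) /\
  (forall n A B, Fn n A -> measurable B ->
     P (A `&` xi n.+1 @^-1` B) = (P A * P (xi n.+1 @^-1` B))%E).

Definition stopping_time {T : Type} (Fn : nat -> set (set T)) (sigma : T -> option nat) : Prop :=
  forall n, Fn n [set w | sigma w = Some n].

(* Main.v *)
(* Write t for the tail of F, and fix a level x. The walk first exceeds x by a
   jump made at some time n < sigma with S_0, ..., S_n <= x, so that
     P(M_sigma > x) = sum_n P(sigma > n, max_(i <= n) S_i <= x < S_(n+1)).
   Long-tailedness shows that the terms with S_n <= K already contribute
   E(sigma) t(x) as x and then K tend to infinity; hence, under the hypothesis,
   the total contribution of S_n > K is at most eps_K t(x), eps_K -> 0.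
   On the other hand xi_1 takes the walk above a level u with probability t(u),
   and since S_sigma <= 0 every upcrossing of u which is not followed by an
   exceedance of x is followed by a downcrossing. A downcrossing of u from
   S_n costs F(u - S_n), which is summable over u, so weighting the levels by
   t(x - u) <= t(x - S_n) and summing over u bounds
     P(sigma > 0) sum_(K <= u < x - L) t(x - u) t(u)
   by the contribution of S_n > K plus P(M_sigma > x) sum_(i > L) t(i),
   which is o(t(x)). For a long-tailed F this is equivalent to F in S^*. *)

Require Import Defs.
From HB Require Import structures.
From mathcomp Require Import all_boot all_order all_algebra.
From mathcomp Require Import all_classical all_reals all_analysis.
From mathcomp Require Import measurable_realfun zify lra.
Set Implicit Arguments. Unset Strict Implicit. Unset Printing Implicit Defensive.
Import Order.TTheory GRing.Theory Num.Theory.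
Import numFieldNormedType.Exports.
Local Open Scope classical_set_scope.
Local Open Scope ring_scope.

(** * Real-valued probabilities and sums *)

Section real_probability.
Context {R : realType} {d : measure_display} {T : measurableType d}.
Variable P : probability T R.
Implicit Types A B : set T.

Definition Pr A : R := fine (P A).

Lemma prE A : measurable A -> P A = (Pr A)%:E.
Proof. by move=> mA; rewrite /Pr fineK// fin_num_measure. Qed.

Lemma pr_ge0 A : 0 <= Pr A.
Proof. by rewrite /Pr fine_ge0. Qed.

Lemma le_pr A B : measurable A -> measurable B -> A `<=` B -> Pr A <= Pr B.
Proof.
move=> mA mB AB; rewrite -lee_fin -!prE//; apply: le_measure => //; exact/mem_set.
Qed.

Lemma pr_le1 A : measurable A -> Pr A <= 1.
Proof. by move=> mA; rewrite -lee_fin -prE// probability_le1. Qed.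

Lemma pr_split A B : measurable A -> measurable B ->
  Pr A = Pr (A `&` B) + Pr (A `\` B).
Proof.
move=> mA mB; apply: EFin_inj; rewrite EFinD -!prE//.
- by rewrite addeC (measureDI P mA mB).
- exact: measurableD.
- exact: measurableI.
Qed.

Lemma prD_le_disjoint A B C : measurable A -> measurable B -> measurable C ->
  A `<=` C -> B `<=` C -> (forall w, A w -> ~ B w) -> Pr A + Pr B <= Pr C.
Proof.
move=> mA mB mC AC BC AB; rewrite (pr_split mC mA) lerD//.
  by apply: le_pr => [//||w Aw]; [exact: measurableI|split => //; exact: AC].
apply: le_pr => [//||w Bw]; first exact: measurableD.
by split; [exact: BC|move=> Aw; exact: AB Bw].
Qed.

Lemma pr_le_cover A B C : measurable A -> measurable B -> measurable C ->
  C `<=` A `|` B -> Pr C <= Pr A + Pr B.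
Proof.
move=> mA mB mC AC; rewrite (pr_split mC mA) lerD//.
  by apply: le_pr => [|//|]; [exact: measurableI|exact: subIsetr].
apply: le_pr => [|//|w [Cw nAw]]; first exact: measurableD.
by case: (AC w Cw).
Qed.

Lemma pr_slices (E : set T) (f : T -> R) (a b : nat) : measurable E ->
  (forall u : R, measurable (E `&` [set w | u < f w])) -> (a <= b)%N ->
  Pr (E `&` [set w | a%:R < f w]) =
  \sum_(a <= j < b) Pr (E `&` [set w | j%:R < f w <= j.+1%:R])
   + Pr (E `&` [set w | b%:R < f w]).
Proof.
move=> mE mf /subnKC <-; elim: (b - a)%N => [|n IH].
  by rewrite addn0 big_geq// add0r.
rewrite IH addnS big_nat_recr/= ?leq_addr// -addrA; congr +%R.
rewrite (pr_split (mf _) (mf (a + n).+1%:R)) addrC.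
congr (Pr _ + Pr _); apply/seteqP; split => w /=.
- by move=> [] [].
- move=> [Ew lw]; split => //; split => //; apply: lt_trans lw.
  by rewrite ltr_nat.
- move=> [[Ew lw] h]; split => //; rewrite lw/= leNgt.
  by apply/negP => wl; apply: h.
- move=> [Ew /andP[lw wl]]; split => //; move=> [_].
  by rewrite ltNge wl.
Qed.

End real_probability.

(** At most [|X w|] integers [i >= 1] satisfy [i <= |X w|]; integrating this pointwise count gives
    the bound [1 + E|X|], where the 1 pays for the term [i = 0]. *)
Lemma sum_pr_norm_ge_bounded {R : realType} {d : measure_display} {T : measurableType d}
  (P : probability T R) (X : T -> R) :
  P.-integrable setT (fun w => (X w)%:E) ->
  exists C, forall k, \sum_(0 <= i < k) Pr P [set w | i%:R <= `|X w|] <= C.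
Proof.
move=> /integrableP[mX iX].
have mabs : measurable_fun setT (fun w => (`|X w|)%:E).
  by apply/measurable_EFinP; apply: measurableT_comp => //; exact/measurable_EFinP.
have mA i : measurable [set w | i%:R <= `|X w|].
  rewrite (_ : [set w | _] = setT `&` (fun w => `|X w|) @^-1` `[i%:R, +oo[%classic).
    by move/measurable_EFinP: mabs; apply => //; exact: measurable_itv.
  by rewrite setTI; apply/seteqP; split => w /=; rewrite in_itv/= andbT.
pose E := (\int[P]_w (`|X w|)%:E)%E.
have E0 : (0 <= E)%E by apply: integral_ge0 => w _; rewrite lee_fin.
have Efin : E \is a fin_num by rewrite ge0_fin_numE.
suff main k : (\sum_(0 <= i < k) P [set w | (i.+1%:R <= `|X w|)%R] <= E)%E.
  exists (1 + fine E) => -[|k].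
    by rewrite big_geq// addr_ge0// fine_ge0.
  rewrite big_nat_recl//= lerD ?pr_le1// -lee_fin fineK// -sumEFin.
  by apply: le_trans (main k); apply: lee_sum => i _; rewrite prE.
rewrite [leLHS](_ : _ = \int[P]_w (\sum_(0 <= i < k)
    (\1_([set w | (i.+1%:R <= `|X w|)%R]) w : R)%:E))%E; last first.
  rewrite ge0_integral_sum//; last first.
    by move=> i; apply/measurable_EFinP; exact: measurable_indic.
  by apply: eq_bigr => i _; rewrite integral_indic// setIT.
apply: ge0_le_integral => //.
- by move=> w _; apply: sume_ge0 => i _; rewrite lee_fin.
- by apply: emeasurable_sum => i; apply/measurable_EFinP; exact: measurable_indic.
move=> w _; rewrite sumEFin lee_fin.
(* If the last indicator is 1, then [k.+1 <= |X w|] and the trivial count [k.+1] suffices; if it is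
   0, the induction hypothesis does. *)
elim: k => [|k IH]; first by rewrite big_geq.
rewrite big_nat_recr//= indicE.
have [kX|Xk] := lerP (k.+1%:R : R) `|X w|; last by rewrite memNset ?addr0//= leNgt Xk.
apply: le_trans kX; rewrite -natr1 lerD//; last by case: (w \in _).
elim: {IH} k => [|k IH]; first by rewrite big_geq.
rewrite big_nat_recr//= -natr1 lerD// indicE; by case: (w \in _).
Qed.

Lemma ler_sum_subrange {R : numDomainType} (f : nat -> R) (a b c d : nat) :
  (a <= c)%N -> (c <= d)%N -> (d <= b)%N -> (forall i, 0 <= f i) ->
  \sum_(c <= i < d) f i <= \sum_(a <= i < b) f i.
Proof.
move=> ac cd db f0; rewrite (big_cat_nat ac (leq_trans cd db))/=.
rewrite (big_cat_nat cd db)/= ler_wpDl ?sumr_ge0//.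
by rewrite ler_wpDr ?sumr_ge0.
Qed.

Lemma tail_sum_small {R : realType} (u : nat -> R) (C e : R) :
  (forall i, 0 <= u i) -> (forall k, \sum_(0 <= i < k) u i <= C) -> 0 < e ->
  exists L, forall N, \sum_(L <= i < N) u i <= e.
Proof.
move=> u0 uC e0.
have cv : cvgn (series u).
  apply: nondecreasing_is_cvgn; first exact/nondecreasing_series.
  by exists C => _ [n _ <-]; exact: uC.
have : \forall L \near \oo, limn (series u) - e < series u L.
  by apply: (cvgr_gt _ cv); rewrite ltrBlDr ltrDl.
move=> [L _ /(_ L (leqnn L)) /= hL]; exists L => N.
have [NL|/ltnW LN] := leqP N L; first by rewrite big_geq// ltW.
have : series u N <= limn (series u).
  by apply: nondecreasing_cvgn_le => //; exact/nondecreasing_series.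
move: hL; rewrite /series/= (big_cat_nat (leq0n L) LN)/=; lra.
Qed.

Lemma ler_sum_reflect {R : realType} (h : R -> R) (N K L : nat) :
  (forall x, 0 <= h x) -> {homo h : x y / x <= y >-> y <= x} ->
  \sum_(K <= u < N - L) h (N%:R - u%:R) <= \sum_(L <= i < N) h i%:R.
Proof.
move=> h0 h_anti; have [KNL|/ltnW NLK] := leqP K (N - L); last first.
  by rewrite big_geq// sumr_ge0.
apply: le_trans (ler_sum_subrange (leq0n K) KNL (leqnn _) (fun u => h0 _)) _.
(* Reversal sends [u] to [N - L - u.+1], so the argument becomes [L + u + 1]; monotonicity of [h]
   absorbs the excess of 1 over [u + L]. *)
rewrite big_nat_rev/= [leRHS](_ : _ = \sum_(0 <= i < N - L) h (i + L)%:R).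
  apply: ler_sum_nat => u /andP[_ uNL]; apply: h_anti.
  by rewrite add0n -natrB ?ler_nat; lia.
by rewrite -{1}[L]add0n big_addn.
Qed.

(** * Level crossings of the stopped walk *)

Section stopped_walk.
Context {R : realType} {d : measure_display} {T : measurableType d}.
Variables (P : probability T R) (xi : nat -> T -> R) (F : R -> R).
Variables (Fn : nat -> set (set T)) (sigma : T -> option nat).
Hypothesis xi_meas : forall n, (1 <= n)%N -> measurable_fun setT (xi n).
Hypothesis xi_df : forall n x, (1 <= n)%N -> fine (P [set w | xi n w <= x]) = F x.
Hypothesis Fn_adm : admissible P xi Fn.
Hypothesis sigma_stop : stopping_time Fn sigma.
Hypothesis Ssigma_le0 :
  P [set w | exists n, sigma w = Some n /\ Ssum xi n w <= 0] = 1%E.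

Local Notation S := (Ssum xi).
Local Notation pr := (Pr P).

(** * Partial sums and the events of the filtration *)

Lemma Ssum0 w : S 0 w = 0.
Proof. by rewrite /Ssum big_geq. Qed.

Lemma SsumS n w : S n.+1 w = S n w + xi n.+1 w.
Proof. by rewrite /Ssum big_nat_recr. Qed.

(** Turns membership in the bare family [Fn n] into measurability on a type, so that closure
    properties and measurable functions become usable for the filtration. *)
Lemma FnE n (A : set T) : Fn n A = measurable (A : set (g_sigma_algebraType (Fn n))).
Proof.
by rewrite /measurable/= /measurable/= sigma_algebra_id//; case: Fn_adm => + _.
Qed.

Lemma Fn_measurable n (A : set T) : Fn n A -> measurable A.
Proof. by case: Fn_adm => _ [+ _]; apply. Qed.

Lemma Fn_Ssum k n : (k <= n)%N ->
  measurable_fun setT (S k : g_sigma_algebraType (Fn n) -> R).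
Proof.
elim: k => [_|k IH kn].
  by rewrite (_ : S 0 = cst 0); [exact: measurable_cst|apply/funext => w; exact: Ssum0].
rewrite (_ : S k.+1 = S k \+ xi k.+1); last by apply/funext => w; exact: SsumS.
apply: measurable_funD; first exact: IH (ltnW kn).
move=> _ B mB; rewrite setTI -FnE; case: Fn_adm => _ [_ [mono [adapt _]]].
by apply: (mono k.+1 n) => //; apply: adapt.
Qed.

Lemma Fn_Ssum_gt k n (a : R) : (k <= n)%N -> Fn n [set w | a < S k w].
Proof.
move=> kn; rewrite FnE; have := Fn_Ssum kn measurableT (measurable_itv `]a, +oo[).
by rewrite setTI /preimage/=; congr measurable; apply/seteqP; split => w /=;
  rewrite in_itv/= andbT.
Qed.

Lemma Fn_Ssum_le k n (a : R) : (k <= n)%N -> Fn n [set w | S k w <= a].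
Proof.
move=> kn; rewrite FnE; have := Fn_Ssum kn measurableT (measurable_itv `]-oo, a]).
by rewrite setTI /preimage/=; congr measurable; apply/seteqP; split => w /=;
  rewrite in_itv/=.
Qed.

Lemma Fn_sigma k n : (k <= n)%N -> Fn n [set w | sigma w <> Some k].
Proof.
move=> kn; have : Fn n [set w | sigma w = Some k].
  by case: Fn_adm => _ [_ [mono _]]; exact: mono (sigma_stop k).
by rewrite !FnE => /measurableC.
Qed.

(** The event that [sigma > n], infinity included, with [S_0, ..., S_n] all in [B]. The set [B]
    stays general so that [alive], [below] and [calm] share one measurability proof. *)
Definition alive_in (B : R -> Prop) n :=
  \bigcap_(k in `I_n.+1) ([set w | sigma w <> Some k] `&` [set w | B (S k w)]).

Lemma Fn_alive_in (B : R -> Prop) n :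
  measurable [set y | B y] -> Fn n (alive_in B n).
Proof.
move=> mB; rewrite FnE; apply: bigcap_measurableType => //= k; rewrite ltnS => kn.
apply: measurableI; first by rewrite -FnE; exact: Fn_sigma.
have := Fn_Ssum kn measurableT mB; by rewrite setTI.
Qed.

Lemma alive_inS B n :
  alive_in B n.+1 = alive_in B n `&`
    ([set w | sigma w <> Some n.+1] `&` [set w | B (S n.+1 w)]).
Proof.
apply/seteqP; split => [w h|w [h1 h2] k].
  by split=> [k kn|]; apply: h => //=; apply: ltnW.
by rewrite /= ltnS leq_eqVlt => /predU1P[->//|]; apply: h1.
Qed.

Definition alive n := alive_in (fun=> True) n.
Definition below x n := alive_in (fun y => y <= x) n.
(** First exceedance of [x], at time [n.+1]; these events are therefore disjoint for different
    [n]. *)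
Definition jump x n := below x n `&` [set w | x < S n.+1 w].

Lemma measurable_setle (x : R) : measurable [set y | y <= x].
Proof. exact: (measurable_itv `]-oo, x]). Qed.

Lemma Fn_alive n : Fn n (alive n).
Proof. by apply: Fn_alive_in; exact: measurableT. Qed.

Lemma Fn_below x n : Fn n (below x n).
Proof. by apply: Fn_alive_in; exact: measurable_setle. Qed.

Lemma Fn_setI n (A B : set T) : Fn n A -> Fn n B -> Fn n (A `&` B).
Proof. by rewrite !FnE; exact: measurableI. Qed.

Lemma pr_indep n (E : set T) (B : set R) : Fn n E -> measurable B ->
  pr (E `&` xi n.+1 @^-1` B) = pr E * pr (xi n.+1 @^-1` B).
Proof.
move=> EF mB; have mE := Fn_measurable EF.
have mX : measurable (xi n.+1 @^-1` B).
  by rewrite -[X in measurable X]setTI; exact: xi_meas.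
apply: EFin_inj; rewrite EFinM -!prE//; last exact: measurableI.
by case: Fn_adm => _ [_ [_ [_ +]]]; apply.
Qed.

Lemma pr_indep_le n (E : set T) y : Fn n E ->
  pr (E `&` [set w | xi n.+1 w <= y]) = pr E * F y.
Proof. by move=> EF; rewrite (pr_indep EF (measurable_setle y)) /Pr xi_df. Qed.

Lemma measurable_xi_le n y : (0 < n)%N -> measurable [set w | xi n w <= y].
Proof.
move=> n0; rewrite -[X in measurable X]setTI.
exact: (xi_meas n0 measurableT (measurable_setle y)).
Qed.

Lemma xi_gtE n y : [set w | y < xi n w] = ~` [set w | xi n w <= y].
Proof. by apply/seteqP; split => w /=; rewrite ltNge => /negP. Qed.

Lemma measurable_xi_gt n y : (0 < n)%N -> measurable [set w | y < xi n w].
Proof. by move=> n0; rewrite xi_gtE; exact/measurableC/measurable_xi_le. Qed.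

Lemma pr_xi_gt n y : (0 < n)%N -> pr [set w | y < xi n w] = tail F y.
Proof.
move=> n0; rewrite /tail -(xi_df y n0).
have mle := measurable_xi_le y n0; rewrite xi_gtE.
by apply: EFin_inj; rewrite EFinB -!prE ?probability_setC//; exact: measurableC.
Qed.

Lemma pr_indep_gt n (E : set T) y : Fn n E ->
  pr (E `&` [set w | y < xi n.+1 w]) = pr E * tail F y.
Proof.
move=> EF; rewrite -(@pr_xi_gt n.+1)//.
have m : measurable [set z | y < z].
  rewrite (_ : [set z | y < z] = `]y, +oo[%classic); first exact: measurable_itv.
  by apply/seteqP; split => z /=; rewrite in_itv/= andbT.
by rewrite (pr_indep EF m).
Qed.

Lemma measurable_Ssum_gt k (a : R) : measurable [set w | a < S k w].
Proof. exact: Fn_measurable (Fn_Ssum_gt a (leqnn k)). Qed.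

Lemma measurable_Ssum_le k (a : R) : measurable [set w | S k w <= a].
Proof. exact: Fn_measurable (Fn_Ssum_le a (leqnn k)). Qed.

Lemma measurable_below x k : measurable (below x k).
Proof. exact: Fn_measurable (Fn_below x k). Qed.

Lemma measurable_jump x k : measurable (jump x k).
Proof. by apply: measurableI; [exact: measurable_below|exact: measurable_Ssum_gt]. Qed.

(** * Balance of the mass above a level *)

Definition Ssigma_gt0 := ~` [set w | exists n, sigma w = Some n /\ S n w <= 0].

Lemma measurable_Ssigma_le0 :
  measurable [set w | exists n, sigma w = Some n /\ S n w <= 0].
Proof.
rewrite [X in measurable X](_ : _ =
    \bigcup_n ([set w | sigma w = Some n] `&` [set w | S n w <= 0])).
  apply: bigcup_measurable => n _; apply: measurableI; last exact: measurable_Ssum_le.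
  exact: Fn_measurable (sigma_stop n).
by apply/seteqP; split => w /=; [move=> [n h]; exists n|move=> [n _ h]; exists n].
Qed.

Lemma pr_Ssigma_gt0 : pr Ssigma_gt0 = 0.
Proof.
rewrite /Pr /Ssigma_gt0 probability_setC; last exact: measurable_Ssigma_le0.
by rewrite Ssigma_le0 subee.
Qed.

(* If the walk is stopped at time n+1 then S_(n+1) <= 0 <= u almost surely, so a
   path above u at time n+1 is either still running or has exceeded x. *)
Lemma crossing_step x u n : 0 <= u ->
  pr (below x n `&` [set w | u < S n.+1 w]) <=
  pr (below x n.+1 `&` [set w | u < S n.+1 w]) + pr (jump x n).
Proof.
move=> u0.
have m1 y k l : measurable (below y k `&` [set w | u < S l w]).
  by apply: measurableI; [exact: measurable_below|exact: measurable_Ssum_gt].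
have m2 := measurable_jump x n.
apply: le_trans (pr_le_cover P (m1 x n.+1 n.+1) m2 (measurableU _ _ (m1 _ _ _) m2)
  (fun w h => h)).
rewrite -[leRHS]addr0 -pr_Ssigma_gt0.
apply: pr_le_cover => //; [exact: measurableU|exact: measurableC measurable_Ssigma_le0|].
move=> w [bw uw]; have [Zw|/contrapT Gw] := pselect (Ssigma_gt0 w); first by right.
left; have [xS|Sx] := ltP x (S n.+1 w); first by right.
left; split => //; rewrite /below alive_inS; split=> //; split => // sw.
move: Gw => [k []]; rewrite sw => -[<-] /(lt_le_trans uw).
by rewrite ltNge u0.
Qed.

Definition down x u n :=
  pr (below x n `&` [set w | S n.+1 w <= u] `&` [set w | u < S n w]).

Lemma down_step x u n :
  pr (below x n `&` [set w | u < S n w]) <=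
  pr (below x n `&` [set w | u < S n.+1 w]) + down x u n.
Proof.
have mb := measurable_below x n.
apply: pr_le_cover.
- exact: measurableI (measurable_Ssum_gt _ _).
- apply: measurableI; last exact: measurable_Ssum_gt.
  exact: measurableI (measurable_Ssum_le _ _).
- exact: measurableI (measurable_Ssum_gt _ _).
move=> w [bw uw]; have [uS|Su] := ltP u (S n.+1 w); first by left.
by right.
Qed.

(** The event that [sigma > 0] and [xi 1] exceeds [u] has the probability on the left. From then on,
    mass above [u] can only stay there, exceed [x], or fall to [u] or lower; [crossing_step] and
    [down_step] account for these alternately, and what stays is at most [pr (alive n.+1)]. *)
Lemma upcrossing_bound x u n : 0 <= x -> 0 <= u ->
  pr (alive 0) * tail F u <=
  pr (alive n.+1) + \sum_(0 <= k < n.+1) (pr (jump x k) + down x u k).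
Proof.
move=> x0 u0.
(* The induction has to retain the mass still above [u] at time [n.+1]; it is relaxed to
   [alive n.+1] only at the end. *)
suff: pr (alive 0) * tail F u <=
  pr (below x n.+1 `&` [set w | u < S n.+1 w])
    + \sum_(0 <= k < n.+1) (pr (jump x k) + down x u k).
  move=> /le_trans; apply; rewrite lerD2r; apply: le_pr.
  - exact: measurableI (measurable_below _ _) (measurable_Ssum_gt _ _).
  - exact: Fn_measurable (Fn_alive _).
  by move=> w [bw _] k /bw[].
elim: n => [|n IH].
  rewrite big_nat1 -(pr_indep_gt _ (Fn_alive 0)) addrA.
  rewrite ler_wpDr ?pr_ge0//; apply: le_trans (crossing_step _ _ u0).
  apply: le_pr.
  - apply: measurableI; first exact: Fn_measurable (Fn_alive _).
    have := measurable_Ssum_gt 1 u; congr measurable.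
    by apply/seteqP; split => w /=; rewrite SsumS Ssum0 add0r.
  - exact: measurableI (measurable_below _ _) (measurable_Ssum_gt _ _).
  move=> w /= [aw uw]; split; last by rewrite SsumS Ssum0 add0r.
  move=> k /= k0; have [sk _] := aw k k0; split => //.
  by move: k0; rewrite ltnS leqn0 => /eqP ->; rewrite Ssum0.
apply: (le_trans IH); rewrite [in leRHS]big_nat_recr//=.
have := crossing_step x n.+1 u0; have := down_step x u n.+1; lra.
Qed.

Lemma tail_df_ge0 y : 0 <= tail F y.
Proof. by rewrite -(@pr_xi_gt 1)// pr_ge0. Qed.

Lemma df_ge0 y : 0 <= F y.
Proof. by rewrite -(@xi_df 1)// fine_ge0. Qed.

Lemma df_mono y z : y <= z -> F y <= F z.
Proof.
move=> yz; rewrite -!(@xi_df 1)//.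
apply: (le_pr P (measurable_xi_le y (ltn0Sn 0)) (measurable_xi_le z (ltn0Sn 0))).
by move=> w /= /le_trans; apply.
Qed.

Lemma tail_df_anti y z : y <= z -> tail F z <= tail F y.
Proof. by move=> yz; rewrite /tail lerD2l lerN2 df_mono. Qed.

(** * Cost of downcrossings, by unit slices of the position *)

Definition slice (N n j : nat) :=
  below N%:R n `&` [set w | j%:R < S n w <= j.+1%:R].

Lemma Fn_slice N n j : Fn n (slice N n j).
Proof.
apply: Fn_setI; first exact: Fn_below.
rewrite (_ : [set w | _] = [set w | j%:R < S n w] `&` [set w | S n w <= j.+1%:R]).
  by apply: Fn_setI; [exact: Fn_Ssum_gt|exact: Fn_Ssum_le].
by apply/seteqP; split => w /=; [move=> /andP[]|move=> [-> ->]].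
Qed.

Lemma measurable_slice N n j : measurable (slice N n j).
Proof. exact: Fn_measurable (Fn_slice N n j). Qed.

Lemma measurable_setI_slice (E : set T) n j : measurable E ->
  measurable (E `&` [set w | j%:R < S n w <= j.+1%:R]).
Proof.
move=> mE.
rewrite (_ : [set w | _] = [set w | j%:R < S n w] `&` [set w | S n w <= j.+1%:R]).
  by do 2 apply: measurableI => //; [exact: measurable_Ssum_gt|exact: measurable_Ssum_le].
by apply/seteqP; split => w /=; [move=> /andP[]|move=> [-> ->]].
Qed.

(** From [S n w > j], reaching [u] or lower takes an increment of at most [u - j], which is
    independent of the slice. No slice beyond [N] occurs, since [S n w <= N] on [below]. *)
Lemma down_le_slices N (u n : nat) : (u <= N)%N ->
  down N%:R u%:R n <= \sum_(u <= j < N) pr (slice N n j) * F (u%:R - j%:R).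
Proof.
move=> uN; have mE : measurable (below N%:R n `&` [set w | S n.+1 w <= u%:R]).
  by apply: measurableI; [exact: measurable_below|exact: measurable_Ssum_le].
rewrite /down (pr_slices P mE _ uN); last first.
  by move=> a; apply: measurableI => //; exact: measurable_Ssum_gt.
rewrite [X in _ + pr X](_ : _ = set0) /Pr ?measure0 ?addr0; last first.
  apply/seteqP; split => // w [[bw _]] /=.
  by have [_ /= Sw] := bw n (leqnn n.+1); rewrite ltNge Sw.
apply: ler_sum => j _; rewrite -/(pr _) -(pr_indep_le _ (Fn_slice N n j)).
apply: le_pr.
- exact: measurable_setI_slice.
- by apply: measurableI; [exact: measurable_slice|exact: measurable_xi_le].
move=> w [[bw +]] /andP[jS Sj]; rewrite /= SsumS => Su.
by split; [split => //; apply/andP|lra].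
Qed.

(** The same lower end [j] serves here: from [S n w > j] an increment above [N - j] leads above [N].
    Downcrossings and jumps can thus be compared slice by slice. *)
Lemma slices_le_jump N (K n : nat) : (K <= N)%N ->
  \sum_(K <= j < N) pr (slice N n j) * tail F (N%:R - j%:R) <=
  pr (jump N%:R n `&` [set w | K%:R < S n w]).
Proof.
move=> KN; rewrite (pr_slices P (measurable_jump _ n) _ KN); last first.
  by move=> a; apply: measurableI; [exact: measurable_jump|exact: measurable_Ssum_gt].
rewrite ler_wpDr ?pr_ge0//; apply: ler_sum => j _.
rewrite -(pr_indep_gt _ (Fn_slice N n j)); apply: le_pr.
- by apply: measurableI; [exact: measurable_slice|exact: measurable_xi_gt].
- by apply: measurable_setI_slice; exact: measurable_jump.
move=> w [[bw /andP[jS Sj]]] /= xw.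
by split; [split => //=; rewrite SsumS; lra|apply/andP].
Qed.

(** For [u <= j] the weight [tail F (N - u)] is at most [tail F (N - j)], which no longer depends on
    [u]. Exchanging the sums leaves the sum of [F (u - j)] over [u], at most [C], times the slice
    bound for jumps. *)
Lemma down_le_jump (C : R) N (K n : nat) :
  (forall a j : nat, \sum_(a <= u < j.+1) F (u%:R - j%:R) <= C) -> (K <= N)%N ->
  \sum_(K <= u < N) tail F (N%:R - u%:R) * down N%:R u%:R n <=
  C * pr (jump N%:R n `&` [set w | K%:R < S n w]).
Proof.
move=> hC KN; have C0 : 0 <= C by apply: le_trans (hC 1 0)%N; rewrite big_geq.
apply: (@le_trans _ _ (\sum_(K <= u < N) \sum_(K <= j < N) if (u <= j)%N then
    tail F (N%:R - u%:R) * (pr (slice N n j) * F (u%:R - j%:R)) else 0)).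
  apply: ler_sum_nat => u /andP[Ku uN]; rewrite -big_mkcond/= -big_distrr/=.
  rewrite ler_wpM2l ?tail_df_ge0//; apply: le_trans (down_le_slices n (ltnW uN)) _.
  by rewrite (big_nat_widenl _ _ _ _ _ Ku).
rewrite exchange_big/=; apply: le_trans (ler_wpM2l C0 (slices_le_jump n KN)).
rewrite big_distrr/=; apply: ler_sum_nat => j /andP[Kj jN].
rewrite -big_mkcond/=.
apply: (@le_trans _ _ (\sum_(K <= u < N | (u <= j)%N)
    (pr (slice N n j) * tail F (N%:R - j%:R)) * F (u%:R - j%:R))).
  apply: ler_sum => u uj; rewrite mulrCA mulrA.
  rewrite ler_wpM2r ?df_ge0// ler_wpM2l ?pr_ge0// tail_df_anti//.
  by rewrite lerD2l lerN2 ler_nat.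
rewrite -big_distrr/= mulrC ler_wpM2r ?mulr_ge0 ?pr_ge0 ?tail_df_ge0//.
apply: le_trans (hC K j); rewrite (big_nat_widen _ _ _ _ _ jN).
by rewrite [leRHS](eq_bigl (fun i => i <= j)%N).
Qed.

(** * Exceedance of a level and the single big jump *)

Definition Mset (x : R) := [set w | (x%:E < Msigma xi sigma w)%E].

(** Gives finite and infinite [sigma] one common form, a countable union of events of the
    filtration. The initial value 0 of the maximum cannot exceed [x >= 0]. *)
Lemma MsetP x w : 0 <= x ->
  Mset x w <-> exists i, (forall k, (k < i)%N -> sigma w <> Some k) /\ x < S i w.
Proof.
move=> x0; rewrite /Mset /= /Msigma; case sw : (sigma w) => [n|].
  rewrite lte_fin big_mkord; split=> [/bigmax_gtP[|[i _ xS]]|[i [hi xS]]].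
  - by rewrite ltNge x0.
  - exists i; split => // k ki -[nk].
    by have := leq_trans ki (ltn_ord i : i <= n)%N; rewrite -nk ltnn.
  - have ni : (i < n.+1)%N.
      by rewrite ltnS leqNgt; apply/negP => /hi; apply.
    by apply/bigmax_gtP; right; exists (Ordinal ni).
split=> [/ereal_sup_gtP[_ [i _ <-]]|[i [_ xS]]].
  by rewrite lte_fin => xS; exists i.
by apply/ereal_sup_gtP; exists (S i w)%:E => //; exists i.
Qed.

Lemma measurable_Mset x : 0 <= x -> measurable (Mset x).
Proof.
move=> x0; rewrite (_ : Mset x = \bigcup_i
  ((\bigcap_(k in `I_i) [set w | sigma w <> Some k]) `&` [set w | x < S i w])).
  apply: bigcup_measurable => i _; apply: measurableI; last exact: measurable_Ssum_gt.
  apply: bigcap_measurableType => //= k _.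
  exact: Fn_measurable (Fn_sigma (leqnn k)).
apply/seteqP; split => w; first by move=> /(MsetP _ x0)[i [h xS]]; exists i.
by move=> [i _ [h xS]]; apply/MsetP => //; exists i.
Qed.

Lemma jump_Mset x n w : 0 <= x -> jump x n w -> Mset x w.
Proof.
by move=> x0 [bw xS]; apply/MsetP => //; exists n.+1; split => // k /bw[].
Qed.

Lemma sum_jump_le x n : 0 <= x ->
  \sum_(0 <= k < n) pr (jump x k) <= pr (Mset x).
Proof.
move=> x0; have mM := measurable_Mset x0.
have mb k : measurable (below x k `&` Mset x).
  by apply: measurableI => //; exact: measurable_below.
case: n => [|n]; first by rewrite big_geq// pr_ge0.
(* The induction carries the part of [Mset x] on which [x] has not been exceeded yet; each [jump]
   splits off a piece disjoint from the rest. *)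
suff : \sum_(0 <= k < n.+1) pr (jump x k) + pr (below x n.+1 `&` Mset x)
    <= pr (Mset x).
  by apply: le_trans; rewrite ler_wpDr ?pr_ge0.
have step k : pr (jump x k) + pr (below x k.+1 `&` Mset x) <= pr (below x k `&` Mset x).
  apply: prD_le_disjoint => //; first exact: measurable_jump.
  - by move=> w jw; split; [exact: jw.1|exact: jump_Mset jw].
  - by move=> w [+ Mw]; rewrite /below alive_inS => -[bw _]; split.
  move=> w [_ /= xS] [+ _]; rewrite /below alive_inS => -[_ [_ /=]].
  by rewrite leNgt xS.
elim: n => [|n IH].
  rewrite big_nat1; apply: le_trans (step 0%N) _; apply: le_pr => // w [] //.
by apply: le_trans IH; rewrite big_nat_recr//= -addrA lerD2l.
Qed.

(* From a calm path any increment > x + K exceeds x, whatever the position. *)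
Definition calm (K : R) n := alive_in (fun y => `|y| <= K) n.

Lemma Fn_calm K n : Fn n (calm K n).
Proof.
apply: Fn_alive_in.
rewrite (_ : [set y | _] = `[- K, K]%classic); first exact: measurable_itv.
by apply/seteqP; split => y /=; rewrite in_itv/= ler_norml.
Qed.

(** A calm path has [S_n >= - K], so an increment above [x + K] exceeds [x], and it stayed below [x]
    because [K <= x]. As [S_n <= K] too, this is disjoint from jumps made from above [K]. *)
Lemma jump_split x K n : 0 <= K <= x ->
  pr (jump x n `&` [set w | K < S n w]) + tail F (x + K) * pr (calm K n) <=
  pr (jump x n).
Proof.
move=> /andP[K0 Kx]; rewrite mulrC -(pr_indep_gt _ (Fn_calm K n)).
apply: prD_le_disjoint; [| |exact: measurable_jump| | |].
- by apply: measurableI; [exact: measurable_jump|exact: measurable_Ssum_gt].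
- by apply: measurableI; [exact: Fn_measurable (Fn_calm K n)|exact: measurable_xi_gt].
- by move=> w [].
- move=> w [cw /= xw]; split.
    by move=> k /cw[sk] /=; rewrite ler_norml => /andP[_ Sk]; split => //=; lra.
  have [_ /=] := cw n (leqnn _); rewrite ler_norml => /andP[Sn _].
  by rewrite SsumS; lra.
- move=> w [_ /= KS] [cw _].
  by have [_ /=] := cw n (leqnn _); rewrite ler_norml => /andP[_]; lra.
Qed.

(** The two ranges differ because [n] will tend to infinity while [m] stays fixed. *)
Lemma one_jump_bound x K n m : 0 <= K <= x -> (m <= n)%N ->
  \sum_(0 <= k < n) pr (jump x k `&` [set w | K < S k w])
    + tail F (x + K) * \sum_(0 <= k < m) pr (calm K k) <= pr (Mset x).
Proof.
move=> Kx mn; have x0 : 0 <= x by case/andP: Kx; exact: le_trans.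
apply: le_trans (sum_jump_le n x0); apply: le_trans (ler_sum _ (fun k _ =>
  jump_split k Kx)); rewrite big_split/= lerD2l -big_distrr/=.
rewrite ler_wpM2l ?tail_df_ge0// (big_cat_nat _ mn)//= ler_wpDr//.
by apply: sumr_ge0 => *; exact: pr_ge0.
Qed.

(** * Expectation of the stopping time as a sum of survival probabilities *)

Lemma sigma_extE w : sigma_ext sigma w = (\sum_(n <oo) (\1_(alive n) w : R)%:E)%E.
Proof.
have aliveE n : alive n w <-> forall k, (k <= n)%N -> sigma w <> Some k.
  by split=> [h k kn|h k kn]; [case: (h k kn)|split => //; exact: h].
apply/esym/cvg_lim => //.
(* The first [n] indicators count the times before both [n] and [sigma]. *)
have -> : (fun n => \sum_(0 <= i < n) (\1_(alive i) w : R)%:E)%E =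
    (fun n => (if sigma w is Some k then minn n k else n)%:R%:E).
  apply/funext => n; rewrite sumEFin; congr EFin.
  elim: n => [|n IH].
    by rewrite big_geq//; case: (sigma w) => [k|]//; rewrite min0n.
  rewrite big_nat_recr//= IH indicE; case sw : (sigma w) => [k|]; last first.
    have aw : alive n w by apply/aliveE => k _; rewrite sw.
    by rewrite mem_set//= natr1.
  have [kn|nk] := leqP k n.
    rewrite memNset ?addr0; last by move/aliveE => /(_ k kn); rewrite sw.
    by rewrite !(minn_idPr _) // ltnW.
  rewrite mem_set; last first.
    by apply/aliveE => i ik; rewrite sw => -[ki]; rewrite ki ltnNge ik in nk.
  by rewrite !(minn_idPl _) ?natr1// ltnW.
rewrite /sigma_ext; case: (sigma w) => [k|].
  apply: cvg_near_cst; near=> n; congr (_%:R%:E); apply/minn_idPr.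
  by near: n; exists k.
exact/cvgeryP/cvgr_idn.
Unshelve. all: by end_near.
Qed.

Lemma measurable_alive n : measurable (alive n).
Proof. exact: Fn_measurable (Fn_alive n). Qed.

Lemma cvg_sum_alive : (\int[P]_w sigma_ext sigma w < +oo)%E ->
  (\sum_(0 <= k < n) pr (alive k)) @[n --> \oo] -->
  fine (\int[P]_w sigma_ext sigma w).
Proof.
have -> : (\int[P]_w sigma_ext sigma w = \sum_(n <oo) (pr (alive n))%:E)%E.
  under eq_integral do rewrite sigma_extE.
  rewrite integral_nneseries//.
  - apply: eq_eseriesr => n _.
    rewrite (integral_indic P measurableT (measurable_alive n)) setIT.
    exact: prE (measurable_alive n).
  - move=> n; apply/measurable_EFinP; apply: measurable_indic; exact: measurable_alive.
move=> foo; set u := (X in fine X).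
have u0 : (0 <= u)%E by apply: nneseries_ge0 => n _ _; rewrite lee_fin pr_ge0.
have cu : (\sum_(0 <= k < n) (pr (alive k))%:E @[n --> \oo] --> u)%E.
  by apply: is_cvg_nneseries => n _ _; rewrite lee_fin pr_ge0.
rewrite -(@fineK _ u) in cu; last by rewrite ge0_fin_numE.
move/fine_cvgP : cu => [_]; apply: cvg_trans; apply: near_eq_cvg; near=> n => /=.
by rewrite sumEFin.
Unshelve. all: by end_near.
Qed.

(** [upcrossing_bound] is summed over the levels with weights [tail F (N - u)]. The downcrossings
    cost at most [C] times the jumps from above [K], which [one_jump_bound] limits to what the calm
    paths leave of [pr (Mset N)]. Cutting the levels at [N - L] will make the sum of the weights
    small. *)
Lemma tail_convolution_bound (C : R) (N K L m : nat) :
  (forall a j : nat, \sum_(a <= u < j.+1) F (u%:R - j%:R) <= C) ->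
  pr (alive n) @[n --> \oo] --> (0 : R) -> (K <= N)%N ->
  pr (alive 0) * \sum_(K <= u < N - L) tail F (N%:R - u%:R) * tail F u%:R <=
  (\sum_(K <= u < N - L) tail F (N%:R - u%:R)) * pr (Mset N%:R)
  + C * (pr (Mset N%:R)
         - tail F (N%:R + K%:R) * \sum_(0 <= k < m) pr (calm K%:R k)).
Proof.
move=> hC alive0 KN.
set A := \sum_(K <= u < N - L) tail F (N%:R - u%:R).
set Y := C * _.
have KN' : 0 <= (K%:R : R) <= N%:R by rewrite ler0n ler_nat.
have C0 : 0 <= C by apply: le_trans (hC 1 0)%N; rewrite big_geq.
(* Only the term with [pr (alive n.+1)] depends on [n], and it vanishes in the limit. *)
suff near_bound : forall n, (m <= n)%N ->
    pr (alive 0) * \sum_(K <= u < N - L) tail F (N%:R - u%:R) * tail F u%:R <=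
    A * pr (alive n.+1) + (A * pr (Mset N%:R) + Y).
  have cv : A * pr (alive n.+1) + (A * pr (Mset N%:R) + Y) @[n --> \oo] -->
      A * 0 + (A * pr (Mset N%:R) + Y).
    apply: cvgD; last exact: cvg_cst.
    apply: cvgM; first exact: cvg_cst.
    by move: alive0; rewrite -(cvg_shiftS (fun n => pr (alive n))).
  rewrite mulr0 add0r in cv; rewrite -(cvg_lim _ cv)//.
  apply: limr_ge; first by apply/cvg_ex; eexists; exact: cv.
  by near=> n; apply: near_bound; near: n; exists m.
move=> n mn.
apply: (@le_trans _ _ (\sum_(K <= u < N - L) (tail F (N%:R - u%:R) *
    (pr (alive n.+1) + pr (Mset N%:R)) +
    \sum_(0 <= k < n.+1) tail F (N%:R - u%:R) * down N%:R u%:R k))).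
  rewrite big_distrr/=; apply: ler_sum => u _.
  rewrite mulrCA -big_distrr/= -mulrDr ler_wpM2l ?tail_df_ge0//.
  have := @upcrossing_bound N%:R u%:R n (ler0n _ _) (ler0n _ _).
  rewrite big_split/= => /le_trans; apply; rewrite -addrA lerD2l lerD2r.
  exact: sum_jump_le.
rewrite big_split/= -big_distrl/= -/A mulrDr -addrA 2!lerD2l exchange_big/=.
apply: (@le_trans _ _
    (\sum_(0 <= k < n.+1) C * pr (jump N%:R k `&` [set w | K%:R < S k w]))).
  apply: ler_sum => k _; apply: le_trans (down_le_jump k hC KN).
  have [KNL|/ltnW NLK] := leqP K (N - L); last first.
    rewrite big_geq//; apply: sumr_ge0 => u _.
    by rewrite mulr_ge0 ?tail_df_ge0// pr_ge0.
  rewrite [leRHS](big_cat_nat KNL (leq_subr _ _))/= ler_wpDr//.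
  by apply: sumr_ge0 => u _; rewrite mulr_ge0 ?tail_df_ge0// pr_ge0.
rewrite -big_distrr/= ler_wpM2l// lerBrDr.
exact: one_jump_bound KN' (leqW mn).
Unshelve. all: by end_near.
Qed.

Lemma cvg_pr_calm k : pr (calm K%:R k) @[K --> \oo] --> pr (alive k).
Proof.
have mc (K : nat) : measurable (calm K%:R k) by exact: Fn_measurable (Fn_calm _ k).
have aE : alive k = \bigcup_K calm K%:R k.
  apply/seteqP; split => w; last first.
    by move=> [K _ cw] i ik; have [si _] := cw i ik.
  (* The sum of all [|S i w|], [i <= k], bounds each of them; the next integer is a valid [K]. *)
  move=> aw; exists (Num.truncn (\sum_(0 <= i < k.+1) `|S i w|)).+1 => // i ik.
  split; first by case: (aw i ik).
  rewrite /=; apply: le_trans (ltW (truncnS_gt _)).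
  have ii : i \in index_iota 0 k.+1 by rewrite mem_index_iota.
  rewrite (bigD1_seq i ii (iota_uniq _ _))/=.
  by rewrite ler_wpDr// sumr_ge0.
have mu : measurable (\bigcup_K calm K%:R k) by rewrite -aE; exact: measurable_alive.
have nd : nondecreasing_seq (fun K : nat => calm K%:R k).
  move=> a b ab; apply/subsetPset => w cw i ik; have [si /= Si] := cw i ik.
  by split => //=; apply: (le_trans Si); rewrite ler_nat.
have cv : (P (calm K%:R k) @[K --> \oo] --> P (\bigcup_K calm K%:R k))%E.
  exact: (nondecreasing_cvg_mu mc mu nd).
by move: cv; rewrite -aE (prE P (measurable_alive k)) => /fine_cvgP[].
Qed.

(** The order of choice matters: first [m] from the series for the expectation, then [K] large for
    the finitely many [k < m]. *)
Lemma calm_sum_gt (e : R) : (\int[P]_w sigma_ext sigma w < +oo)%E -> 0 < e ->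
  exists m, \forall K \near \oo,
    fine (\int[P]_w sigma_ext sigma w) - e < \sum_(0 <= k < m) pr (calm K%:R k).
Proof.
move=> foo e0; set s := fine _.
have : \forall m \near \oo, s - e < \sum_(0 <= k < m) pr (alive k).
  by apply: (cvgr_gt s (cvg_sum_alive foo)); rewrite ltrBlDr ltrDl.
move=> [m _ /(_ m (leqnn m))/= hm]; exists m.
have cv : \sum_(0 <= k < m) pr (calm K%:R k) @[K --> \oo] -->
    \sum_(0 <= k < m) pr (alive k).
  elim: {hm} m => [|m IH].
    by under eq_fun do rewrite big_geq//; rewrite big_geq//; exact: cvg_cst.
  under eq_fun do rewrite big_nat_recr//=.
  by rewrite big_nat_recr//=; apply: cvgD => //; exact: cvg_pr_calm.
exact: (cvgr_gt _ cv).
Qed.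

Lemma cvg_pr_alive : (\int[P]_w sigma_ext sigma w < +oo)%E ->
  pr (alive n) @[n --> \oo] --> (0 : R).
Proof.
by move=> /cvg_sum_alive cv; apply: cvg_series_cvg_0; apply/cvg_ex; eexists; exact: cv.
Qed.

(** Both events [xi 1 <= - i] and [xi 1 > i] lie in [i <= |xi 1|], so integrability controls the two
    tails by one constant. *)
Lemma df_sum_bounded : P.-integrable setT (fun w => (xi 1 w)%:E) ->
  exists C, (forall a j : nat, \sum_(a <= u < j.+1) F (u%:R - j%:R) <= C) /\
            (forall k, \sum_(0 <= i < k) tail F i%:R <= C).
Proof.
move=> iX; have [C hC] := sum_pr_norm_ge_bounded iX.
have mabs (i : nat) : measurable [set w | i%:R <= `|xi 1 w|].
  rewrite (_ : [set w | _] = setT `&` (fun w => `|xi 1 w|) @^-1` `[i%:R, +oo[%classic).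
    have mX : measurable_fun setT (fun w => `|xi 1 w|).
      by apply: measurableT_comp => //; exact: xi_meas.
    exact: (mX measurableT _ (measurable_itv `[i%:R, +oo[)).
  by rewrite setTI; apply/seteqP; split => w /=; rewrite in_itv/= andbT.
exists C; split=> [a j|k]; last first.
  apply: le_trans (hC k); apply: ler_sum => i _; rewrite -(@pr_xi_gt 1)//.
  apply: le_pr => [| |w /= iX'] //; first exact: measurable_xi_gt.
  exact: le_trans (ltW iX') (ler_norm _).
apply: le_trans (hC j.+1).
have [aj|/ltnW ja] := leqP a j.+1; last first.
  by rewrite big_geq// sumr_ge0// => i _; exact: pr_ge0.
apply: le_trans (ler_sum_subrange (leq0n a) aj (leqnn _) (fun u => df_ge0 _)) _.
rewrite [leRHS]big_nat_rev/=; apply: ler_sum_nat => u /andP[_ uj].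
rewrite add0n subSS -(@xi_df 1)//.
apply: le_pr => [| |w /= wu] //; first exact: measurable_xi_le.
by rewrite natrB// -normrN; apply: le_trans (ler_norm _); lra.
Qed.

(** In [tail_convolution_bound] the first term is small because the weights sum to at most [dl], the
    second because [pr (Mset N)] and the calm contribution are both close to [s * tail F N]. *)
Lemma tail_convolution_small (e : R) : 0 < e ->
  P.-integrable setT (fun w => (xi 1 w)%:E) -> long_tailed F ->
  0 < pr (alive 0) -> (\int[P]_w sigma_ext sigma w < +oo)%E ->
  (fun x => pr (Mset x) / tail F x) x @[x --> +oo] -->
    fine (\int[P]_w sigma_ext sigma w) ->
  exists k, \forall N \near \oo,
    \sum_(k <= u < N - k) tail F (N%:R - u%:R) * tail F u%:R <= e * tail F N%:R.
Proof.
move=> e0 iX [t_gt0 Flong] p0 foo; set s := fine _ => Mlim.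
set p := pr (alive 0) in p0 *.
have [C [hC tC]] := df_sum_bounded iX.
have C0 : 0 <= C by apply: le_trans (hC 1 0)%N; rewrite big_geq.
have s0 : 0 <= s.
  apply/fine_ge0/integral_ge0 => w _.
  by rewrite /sigma_ext; case: (sigma w) => // n; rewrite lee_fin.
(* The errors will add up to [dl * ((s + dl) + C * (2 + s - dl))] times [tail F N], at most [dl * D]
   times it; [dl] is chosen to bring this below [e * p]. *)
pose D := (s + 1) + C * (2 + s).
have D0 : 0 < D by rewrite ltr_pwDl ?mulr_ge0//; lra.
pose dl := Num.min (1 / 2) (e * p / D).
have dl0 : 0 < dl by rewrite lt_min divr_gt0//= divr_gt0// mulr_gt0.
have dl1 : dl <= 1 / 2 by rewrite ge_min lexx.
have dlD : dl * D <= e * p by rewrite -ler_pdivlMr// ge_min lexx orbT.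
have [L hL] := tail_sum_small (fun i => tail_df_ge0 i%:R) tC dl0.
have [m [K0 _ hK0]] := calm_sum_gt foo dl0.
(* [K0] serves the calm sum, [L] ensures [N - K <= N - L], and 1 makes [K] a positive shift for
   long-tailedness. *)
pose K := maxn K0 (maxn L 1).
have LK : (L <= K)%N by rewrite !leq_max leqnn orbT.
have K1 : (0 < K)%N by rewrite !leq_max leqnn !orbT.
have {hK0}hK : s - dl < \sum_(0 <= k < m) pr (calm K%:R k) by apply: hK0; exact: leq_maxl.
have [A1 [_ hA1]] : \forall x \near +oo, pr (Mset x) / tail F x < s + dl.
  by apply: (cvgr_lt _ Mlim); rewrite ltrDl.
have KR0 : 0 < (K%:R : R) by rewrite ltr0n.
have [A2 [_ hA2]] : \forall x \near +oo, tail F (x - K%:R) / tail F x < 1 + dl.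
  by apply: (cvgr_lt _ (Flong _ KR0)); rewrite ltrDl.
exists K; near=> N.
have tN := t_gt0 N%:R.
have KN : (K <= N)%N by near: N; exists K.
have hM : pr (Mset N%:R) <= (s + dl) * tail F N%:R.
  rewrite -ler_pdivrMr//; apply/ltW/hA1.
  by near: N; exact: nbhs_infty_gtr.
(* Long-tailedness shifts to the left, so it is applied at [N + K]; then
   [(1 - dl) * (1 + dl) <= 1]. *)
have hS : (1 - dl) * tail F N%:R <= tail F (N%:R + K%:R).
  have : tail F N%:R / tail F (N%:R + K%:R) < 1 + dl.
    rewrite -[in X in tail F X / _](addrK K%:R N%:R); apply: hA2.
    by rewrite ltr_wpDr// ; near: N; exact: nbhs_infty_gtr.
  rewrite ltr_pdivrMr// => /ltW hlt.
  have : (1 - dl) * tail F N%:R <= (1 - dl) * ((1 + dl) * tail F (N%:R + K%:R)).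
    by rewrite ler_wpM2l//; lra.
  move=> /le_trans; apply; rewrite mulrA ler_piMl ?(ltW (t_gt0 _))//.
  by have := sqr_ge0 dl; lra.
have b0 : 0 <= \sum_(0 <= k < m) pr (calm K%:R k).
  by apply: sumr_ge0 => *; exact: pr_ge0.
have conv := tail_convolution_bound L m hC (cvg_pr_alive foo) KN.
have sumL : \sum_(K <= u < N - L) tail F (N%:R - u%:R) <= dl.
  apply: le_trans (hL N); apply: ler_sum_reflect; first exact: tail_df_ge0.
  by move=> x y; exact: tail_df_anti.
have -> : e * tail F N%:R = p^-1 * (p * (e * tail F N%:R)) by rewrite mulKf// gt_eqF.
rewrite -[leLHS](mulKf (lt0r_neq0 p0)) ler_wpM2l ?invr_ge0 ?(ltW p0)//.
apply: (@le_trans _ _ (p * \sum_(K <= u < N - L) tail F (N%:R - u%:R) * tail F u%:R)).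
  rewrite ler_wpM2l ?(ltW p0)//.
  have [KNL|/ltnW NLK] := leqP K (N - K); last first.
    by rewrite big_geq// sumr_ge0// => *; rewrite mulr_ge0 ?tail_df_ge0.
  apply: ler_sum_subrange => //; first exact: leq_sub2l.
  by move=> *; rewrite mulr_ge0 ?tail_df_ge0.
apply: (le_trans conv).
have h1 : (\sum_(K <= u < N - L) tail F (N%:R - u%:R)) * pr (Mset N%:R) <=
    dl * ((s + dl) * tail F N%:R).
  by apply: ler_pM => //; [apply: sumr_ge0 => *; exact: tail_df_ge0|exact: pr_ge0].
have h2 : (1 - dl) * tail F N%:R * (s - dl) <=
    tail F (N%:R + K%:R) * \sum_(0 <= k < m) pr (calm K%:R k).
  apply: (@le_trans _ _ ((1 - dl) * tail F N%:R * \sum_(0 <= k < m) pr (calm K%:R k))).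
    by rewrite ler_wpM2l ?(ltW hK)// mulr_ge0 ?(ltW tN)//; lra.
  by rewrite ler_wpM2r.
have h3 : C * (pr (Mset N%:R)
      - tail F (N%:R + K%:R) * \sum_(0 <= k < m) pr (calm K%:R k)) <=
   C * ((s + dl) * tail F N%:R - (1 - dl) * tail F N%:R * (s - dl)).
  by rewrite ler_wpM2l// lerB.
apply: (le_trans (lerD h1 h3)).
apply: (@le_trans _ _ (dl * D * tail F N%:R)); last first.
  by rewrite [leRHS]mulrA (mulrC p) ler_wpM2r ?(ltW tN).
have -> : dl * ((s + dl) * tail F N%:R) +
  C * ((s + dl) * tail F N%:R - (1 - dl) * tail F N%:R * (s - dl)) =
  dl * ((s + dl) + C * (2 + s - dl)) * tail F N%:R by lra.
rewrite ler_wpM2r ?(ltW tN)// ler_wpM2l ?(ltW dl0)// lerD//; first by lra.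
by rewrite ler_wpM2l//; lra.
Unshelve. all: by end_near.
Qed.

End stopped_walk.

(** * From the discrete convolution to the class S* *)

(** By uniqueness it suffices to compare lengths: the preimage of []a, b]] is [[x - b, x - a[]. *)
Lemma lebesgue_measure_reflect {R : realType} (x : R) (A : set R) : measurable A ->
  pushforward lebesgue_measure ((fun y => x - y) : _ -> measurableTypeR R) A =
  lebesgue_measure A.
Proof.
have mphi : measurable_fun setT
    ((fun y => x - y) : measurableTypeR R -> measurableTypeR R).
  exact: measurable_funB.
move=> mA; apply/esym/lebesgue_measure_unique => //= _ [[a b]] _ <-.
rewrite /pushforward (_ : _ @^-1` _ = `[x - b, x - a[%classic); last first.
  apply/seteqP; split => y /=; rewrite !in_itv/= => /andP[h1 h2]; apply/andP; split; lra.
rewrite !lebesgue_measure_itv/= !lte_fin -!EFinB ltrD2l ltrN2.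
by case: ifPn => // _; congr EFin; lra.
Qed.

Lemma ge0_integral_reflect {R : realType} (x K : R) (f : R -> \bar R) :
  measurable_fun setT f -> (forall y, 0 <= f y)%E ->
  (\int[@lebesgue_measure R]_(y in `](x - K)%R, x]) f (x - y)%R =
   \int[@lebesgue_measure R]_(y in `[0%R, K[) f y)%E.
Proof.
move=> mf f0.
have mphi : measurable_fun setT
    ((fun y => x - y) : measurableTypeR R -> measurableTypeR R).
  exact: measurable_funB.
rewrite (_ : `]x - K, x]%classic =
    ((fun y => x - y) : _ -> measurableTypeR R) @^-1` `[0%R, K[); last first.
  apply/seteqP; split => y /=; rewrite !in_itv/= => /andP[h1 h2].
    by apply/andP; split; lra.
  by apply/andP; split; lra.
have mI : measurable (`[0%R, K[%classic : set (measurableTypeR R)).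
  exact: measurable_itv.
have := @ge0_integral_pushforward _ _ _ _ R _ mphi lebesgue_measure _ f mI
  (measurable_funS measurableT (@subsetT _ _) mf) (fun y _ => f0 y).
move=> /esym /= ->.
by apply: eq_measure_integral => //= A mA AS; exact: lebesgue_measure_reflect.
Qed.

Lemma ge0_integral_itv_split {R : realType} (f : R -> R) (a x b : itv_bound R) :
  measurable_fun setT f -> (forall y, 0 <= f y) -> (a <= x)%O -> (x <= b)%O ->
  (\int[@lebesgue_measure R]_(y in [set` Interval a b]) (f y)%:E =
   \int[@lebesgue_measure R]_(y in [set` Interval a x]) (f y)%:E +
   \int[@lebesgue_measure R]_(y in [set` Interval x b]) (f y)%:E)%E.
Proof.
move=> mf f0 ax xb; rewrite (itv_bndbnd_setU ax xb) ge0_integral_setU//=.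
- by apply/measurable_EFinP; exact: measurable_funS mf.
- by move=> y _; rewrite lee_fin.
rewrite disj_set2E; apply/eqP/seteqP; split => // y [] /=.
rewrite !itv_boundlr => /andP[_ yx] /andP[xy _].
by have := le_trans yx xy; rewrite bnd_simp ltxx.
Qed.

Lemma integral_le_unit_sum {R : realType} (f : R -> R) (c : nat -> R) (a b : nat) :
  measurable_fun setT f -> (forall y, 0 <= f y) -> (a <= b)%N ->
  (forall i y, (a <= i < b)%N -> i%:R <= y < i.+1%:R -> f y <= c i) ->
  (\int[@lebesgue_measure R]_(y in `[(a%:R : R), b%:R[) (f y)%:E <=
   (\sum_(a <= i < b) c i)%:E)%E.
Proof.
move=> mf f0 /subnKC <-; elim: (b - a)%N => [|n IH] fc.
  by rewrite addn0 big_geq// set_itvco0 integral_set0.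
rewrite addnS big_nat_recr ?leq_addr//= EFinD.
have mfE (A : set R) : measurable_fun A (fun y => (f y)%:E).
  by apply/measurable_EFinP; exact: measurable_funS mf.
rewrite (@ge0_integral_itv_split _ _ _ (BLeft (a + n)%:R))//; last 2 first.
  by rewrite bnd_simp ler_nat leq_addr.
  by rewrite bnd_simp ler_nat.
apply: leeD.
  by apply: IH => i y /andP[ai ib]; apply: fc; rewrite ai addnS leqW.
apply: (@le_trans _ _ (\int[@lebesgue_measure R]_(y in `[((a + n)%:R : R), (a + n).+1%:R[)
   (cst (c (a + n)%N)%:E y))%E).
  apply: ge0_le_integral => //=.
  - by move=> y _; rewrite lee_fin.
  - exact: mfE.
  - by move=> y; rewrite in_itv/= lee_fin => h; apply: fc h;
      rewrite leq_addr addnS ltnSn.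
rewrite integral_cst//= lebesgue_measure_itv/= lte_fin ltr_nat ltnSn -EFinB.
by rewrite -natrB// subSnn mule1.
Qed.

(** * Splitting the tail convolution integral into thirds *)

Section sstar_criterion.
Context {R : realType}.
Variable F : R -> R.
Local Notation h := (tail F).
Local Notation mu := (@lebesgue_measure R).
Hypothesis h_anti : {homo h : x y / x <= y >-> y <= x}.
Hypothesis h_gt0 : forall x, 0 < h x.

Let h0 x : 0 <= h x. Proof. exact: ltW. Qed.

Lemma measurable_tail : measurable_fun setT h.
Proof. exact: nonincreasing_measurable. Qed.

Lemma measurable_tailE (A : set R) : measurable_fun A (fun y => (h y)%:E).
Proof. by apply/measurable_EFinP; exact: measurable_funS measurable_tail. Qed.

Variable C : R.
Hypothesis h_sum : forall k, \sum_(0 <= i < k) h i%:R <= C.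

Lemma cvg_mplus :
  (\int[mu]_(y in `[(0%R : R), K%:R[) (h y)%:E @[K --> \oo] --> mplus F)%E.
Proof.
rewrite /mplus (_ : `[(0%R : R), +oo[%classic =
    \bigcup_(K : nat) `[(0%R : R), K%:R[%classic).
  apply: ge0_nondecreasing_set_cvg_integral => //.
  - move=> a b ab; apply/subsetPset => y /=; rewrite !in_itv/= => /andP[-> /lt_le_trans].
    by apply; rewrite ler_nat.
  - by move=> K; exact: measurable_tailE.
  - by move=> K y _; rewrite lee_fin.
apply/seteqP; split => y /=; rewrite in_itv/= ?andbT.
  by move=> y0; exists (Num.truncn y).+1 => //=; rewrite in_itv/= y0 truncnS_gt.
by move=> [K _ /=]; rewrite in_itv/= => /andP[].
Qed.

Lemma integral_le_mplus (K : nat) :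
  (\int[mu]_(y in `[(0%R : R), K%:R[) (h y)%:E <= mplus F)%E.
Proof.
apply: ge0_subset_integral => //=; first exact: measurable_tailE.
- by move=> y _; rewrite lee_fin.
by move=> y /=; rewrite !in_itv/= andbT => /andP[].
Qed.

Lemma mplus_le : (mplus F <= C%:E)%E.
Proof.
rewrite -(cvg_lim _ cvg_mplus)//; apply: lime_le.
  by apply/cvg_ex; eexists; exact: cvg_mplus.
near=> K; apply: le_trans (_ : ((\sum_(0 <= i < K) h i%:R)%:E <= _)%E); last first.
  by rewrite lee_fin h_sum.
have := @integral_le_unit_sum _ h (fun i => h i%:R) 0 K measurable_tail h0.
by rewrite mulr0n; apply => // i y _ /andP[iy _]; exact: h_anti.
Unshelve. all: by end_near.
Qed.

Let I (K : nat) : R := fine (\int[mu]_(y in `[(0%R : R), K%:R[) (h y)%:E)%E.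
Let mp := fine (mplus F).

Lemma mplus_fin : mplus F \is a fin_num.
Proof.
rewrite ge0_fin_numE ?(le_lt_trans mplus_le) ?ltry//.
by apply: integral_ge0 => y _; rewrite lee_fin.
Qed.

Lemma integral_tailE K : (\int[mu]_(y in `[(0%R : R), K%:R[) (h y)%:E)%E = (I K)%:E.
Proof.
rewrite /I fineK// ge0_fin_numE; last by apply: integral_ge0 => y _; rewrite lee_fin.
by apply: le_lt_trans (integral_le_mplus K) _; rewrite ltey_eq mplus_fin.
Qed.

Lemma integral_tail_le K : I K <= mp.
Proof. by rewrite -lee_fin -integral_tailE /mp fineK ?mplus_fin// integral_le_mplus. Qed.

Lemma integral_tail_ge0 K : 0 <= I K.
Proof.
by rewrite -lee_fin -integral_tailE; apply: integral_ge0 => y _; rewrite lee_fin.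
Qed.

Lemma cvg_integral_tail : I K @[K --> \oo] --> mp.
Proof. by have := cvg_mplus; rewrite -(fineK mplus_fin) => /fine_cvgP[]. Qed.

Lemma fine_mplus_gt0 : 0 < mp.
Proof.
apply: lt_le_trans (integral_tail_le 1); apply: lt_le_trans (h_gt0 1) _.
rewrite -lee_fin -integral_tailE.
rewrite [leLHS](_ : _ = \int[mu]_(y in `[(0%R : R), 1%:R[) (cst (h 1)%:E y))%E.
  apply: ge0_le_integral => //=.
  - by move=> y _; rewrite lee_fin.
  - exact: measurable_tailE.
  - by move=> y; rewrite in_itv/= lee_fin => /andP[_ /ltW]; exact: h_anti.
by rewrite integral_cst//= lebesgue_measure_itv/= lte_fin ltr01 oppr0 adde0 mule1.
Qed.

(* The outer thirds [0, K[ and ]x - K, x] contribute equally by reflection, the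
   middle third is bounded by a sum over unit intervals. *)
Lemma tailconv_bounds (K N : nat) (x : R) : N.+1%:R <= x < N.+2%:R ->
  (K + K <= N)%N ->
  2 * h x * I K <= tailconv F x <=
  2 * h (x - K%:R) * I K + \sum_(K <= u < N.+2 - K) h (N%:R - u%:R) * h u%:R.
Proof.
move=> /andP[Nx xN] KN.
have KN' : K%:R + K%:R <= (N%:R : R) by rewrite -natrD ler_nat.
have K0 : 0 <= (K%:R : R) by [].
have NS1 : (N.+1%:R : R) = N%:R + 1 by rewrite natr1.
have NS2 : (N.+2%:R : R) = N%:R + 2 by rewrite -(natrD _ N 2) addn2.
pose f y := h (x - y) * h y.
have f0 y : 0 <= f y by rewrite mulr_ge0.
have mf : measurable_fun setT f.
  apply: measurable_funM; last exact: measurable_tail.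
  apply: measurableT_comp; first exact: measurable_tail.
  exact: measurable_funB.
have mfE (A : set R) : measurable_fun A (fun y => (f y)%:E).
  by apply/measurable_EFinP; exact: measurable_funS mf.
have A3 : (\int[mu]_(y in `](x - K%:R)%R, x]) (f y)%:E =
    \int[mu]_(y in `[0%R, K%:R[) (f y)%:E)%E.
  rewrite -(@ge0_integral_reflect _ x K%:R (fun y => (f y)%:E))//.
  by apply: eq_integral => y _; rewrite /f subKr mulrC.
have split3 : (\int[mu]_(y in `[(0%R : R), x]) (f y)%:E =
    \int[mu]_(y in `[0%R, K%:R[) (f y)%:E +
    (\int[mu]_(y in `[(K%:R : R), (x - K%:R)%R]) (f y)%:E +
    \int[mu]_(y in `[0%R, K%:R[) (f y)%:E))%E.
  rewrite (@ge0_integral_itv_split _ _ _ (BLeft K%:R))//; last by rewrite bnd_simp; lra.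
  rewrite [X in (_ + X)%E](@ge0_integral_itv_split _ _ _ (BRight (x - K%:R)))//.
  - by rewrite A3.
  - by rewrite bnd_simp; lra.
  - by rewrite bnd_simp; lra.
have scaleI c : 0 <= c ->
    (c * I K)%:E = (\int[mu]_(y in `[0%R, K%:R[) (c%:E * (h y)%:E))%E.
  move=> c0; rewrite EFinM -integral_tailE ge0_integralZl_EFin//.
  - by move=> y _; rewrite lee_fin.
  - exact: measurable_tailE.
have lo : ((h x * I K)%:E <= \int[mu]_(y in `[0%R, K%:R[) (f y)%:E)%E.
  rewrite scaleI//.
  apply: ge0_le_integral => //=.
  - by move=> y _; rewrite lee_fin mulr_ge0.
  - apply/measurable_EFinP/measurable_funM => //.
    exact: measurable_funS measurable_tail.
  - exact: mfE.
  - move=> y; rewrite in_itv/= lee_fin => /andP[y0 _].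
    by rewrite ler_wpM2r// h_anti//; lra.
have up : (\int[mu]_(y in `[0%R, K%:R[) (f y)%:E <= (h (x - K%:R) * I K)%:E)%E.
  rewrite scaleI//.
  apply: ge0_le_integral => //=.
  - by move=> y _; rewrite lee_fin.
  - exact: mfE.
  - apply/measurable_EFinP/measurable_funM => //.
    exact: measurable_funS measurable_tail.
  - move=> y; rewrite in_itv/= lee_fin => /andP[y0 yK].
    by rewrite ler_wpM2r// h_anti//; lra.
(* For [y] in [[i, i + 1[], [N.+1 <= x] gives [x - y > N - i]; and [x < N.+2] puts the end [x - K]
   below [N.+2 - K]. *)
have mid : (\int[mu]_(y in `[(K%:R : R), (x - K%:R)%R]) (f y)%:E <=
    (\sum_(K <= u < N.+2 - K) h (N%:R - u%:R) * h u%:R)%:E)%E.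
  have Kb : (K <= N.+2 - K)%N by lia.
  have bE : (N.+2 - K)%:R = N%:R + 2 - K%:R :> R by rewrite natrB ?NS2//; lia.
  apply: (@le_trans _ _ (\int[mu]_(y in `[(K%:R : R), (N.+2 - K)%:R[) (f y)%:E)%E).
    apply: ge0_subset_integral => //=.
    - exact: mfE.
    - by move=> y _; rewrite lee_fin.
    - move=> y /=; rewrite !in_itv/= => /andP[-> yx] /=.
      by rewrite bE; lra.
  apply: integral_le_unit_sum => // i y _ /andP[iy yi]; rewrite /f.
  have := natr1 i (R := R) => i1.
  by apply: ler_pM => //; apply: h_anti => //; lra.
have mid0 : (0 <= \int[mu]_(y in `[(K%:R : R), (x - K%:R)%R]) (f y)%:E)%E.
  by apply: integral_ge0 => y _; rewrite lee_fin.
rewrite /tailconv /Rintegral -/f split3.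
(* The bounds exclude infinite values, so [fine] respects the sum and linear arithmetic remains. *)
move: lo up mid mid0.
case: (\int[mu]_(y in `[0%R, K%:R[) (f y)%:E)%E => [a| |]//.
case: (\int[mu]_(y in `[(K%:R : R), (x - K%:R)%R]) (f y)%:E)%E => [b| |]//.
by rewrite !lee_fin /= => *; lra.
Qed.

Hypothesis F_long : long_tailed F.
Hypothesis h_middle : forall e, 0 < e -> exists k, \forall N \near \oo,
  \sum_(k <= u < N - k) h (N%:R - u%:R) * h u%:R <= e * h N%:R.

Lemma Sstar_of_middle : Sstar F.
Proof.
split; first exact: h_gt0.
split; first by rewrite ltey_eq mplus_fin.
have le_sub2 (a b c : nat) : (b.+2 <= c)%N -> (a.+2 - c <= a - b)%N by lia.
have le_subl (a b : nat) : (a + a <= b)%N -> (a <= b.+2 - a)%N by lia.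
rewrite -/mp; have mp0 := fine_mplus_gt0.
apply/cvgrPdist_le => e e0.
(* The allowed error is [2 * mp * e * h x]. Since [h N <= 2 * h x], the middle uses half of it; the
   outer thirds use the other half through [h (x - K) <= (1 + e / 2) * h x]. *)
have e1 : 0 < mp * e / 2 by rewrite divr_gt0// mulr_gt0.
have [k [N0 _ kN0]] := h_middle e1.
have : \forall K \near \oo, mp - mp * e < I K.
  by apply: (cvgr_gt _ cvg_integral_tail); rewrite ltrBlDr ltrDl mulr_gt0.
(* The 2 in [k.+2] fits the upper limit [N.+2 - K] of the middle sum under [N - k]. *)
move=> [K0 _ hK0]; pose K := maxn K0 k.+2.
have hK : mp - mp * e < I K by apply: hK0; exact: leq_maxl.
have kK : (k.+2 <= K)%N by exact: leq_maxr.
have KP : 0 < (K%:R : R) by rewrite ltr0n; apply: leq_trans kK.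
near=> x.
have x0 : 0 <= x by near: x; apply: nbhs_pinfty_ge; rewrite num_real.
have hxK : h (x - K%:R) / h x < 1 + e / 2.
  near: x; apply: (cvgr_lt _ (F_long.2 _ KP)); rewrite ltrDl; exact: divr_gt0.
have hx2 : h (x - 2) / h x < 2.
  by near: x; apply: (cvgr_lt _ (F_long.2 2 _)) => //; lra.
(* One less than the integer part, so that [N.+1 <= x < N.+2]; in particular [x - 2 < N]. *)
pose N := (Num.truncn x).-1.
have x_big : (N0 + K + K).+1%:R <= x by near: x; apply: nbhs_pinfty_ge; rewrite num_real.
have tx : (N0 + K + K < Num.truncn x)%N by rewrite truncn_ge_nat.
have NE : N.+1 = Num.truncn x by rewrite prednK//; exact: leq_ltn_trans tx.
have xN : N.+1%:R <= x < N.+2%:R by rewrite NE truncn_itv.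
have KN : (N0 + K + K <= N)%N by rewrite -ltnS NE.
have KKN : (K + K <= N)%N by apply: leq_trans KN; rewrite -addnA leq_addl.
have N0N : (N0 <= N)%N by apply: leq_trans KN; rewrite -addnA leq_addr.
have /andP[lo up] := tailconv_bounds xN KKN.
have mid : \sum_(K <= u < N.+2 - K) h (N%:R - u%:R) * h u%:R <= mp * e / 2 * h N%:R.
  apply: le_trans (kN0 N N0N).
  have k2K : (k <= K)%N by exact: leq_trans (leqW (leqnSn k)) kK.
  apply: (ler_sum_subrange k2K (le_subl _ _ KKN) (le_sub2 _ _ _ kK)) => u.
  by rewrite mulr_ge0.
have hx := h_gt0 x.
have hN : h N%:R <= h (x - 2).
  apply: h_anti; have /andP[_] := xN; rewrite -addn2 natrD; lra.
have D0 : 0 < 2 * mp * h x by rewrite !mulr_gt0.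
rewrite ler_norml lerBlDr lerBrDr; apply/andP; split.
  rewrite addrC -lerBrDr opprK ler_pdivrMr//; apply: (le_trans up).
  have {hxK}hxK : h (x - K%:R) <= (1 + e / 2) * h x by rewrite -ler_pdivrMr// ltW.
  have {}hN : h N%:R <= 2 * h x by rewrite (le_trans hN)// -ler_pdivrMr// ltW.
  have IK : h (x - K%:R) * I K <= (1 + e / 2) * h x * mp.
    by apply: ler_pM => //; [exact: integral_tail_ge0|exact: integral_tail_le].
  have : mp * e / 2 * h N%:R <= mp * e / 2 * (2 * h x) by rewrite ler_wpM2l// ltW.
  lra.
rewrite addrC -lerBlDr ler_pdivlMr//; apply: le_trans lo.
have : h x * (mp - mp * e) <= h x * I K by rewrite ler_wpM2l// ltW.
lra.
Unshelve. all: by end_near.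
Qed.

End sstar_criterion.

Theorem theorem1 (R : realType) (d : measure_display) (T : measurableType d)
  (P : probability T R) (xi : nat -> T -> R) (F : R -> R) (m : R)
  (Fn : nat -> set (set T)) (sigma : T -> option nat) :
  (* standing assumptions: i.i.d. with distribution function F *)
  (forall n, (1 <= n)%N -> measurable_fun setT (xi n)) ->
  iid_indep P xi ->
  (forall n x, (1 <= n)%N -> fine (P [set w | xi n w <= x]) = F x) ->
  0 < m ->
  P.-integrable setT (fun w => (xi 1 w)%:E) ->
  (\int[P]_w (xi 1 w)%:E = (- m)%:E)%E ->
  long_tailed F ->
  (* the stopping time *)
  admissible P xi Fn ->
  stopping_time Fn sigma ->
  (0 < P [set w | sigma w <> Some 0%N])%E ->
  P [set w | exists n, sigma w = Some n /\ Ssum xi n w <= 0] = 1%E ->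
  (\int[P]_w sigma_ext sigma w < +oo)%E ->
  (fun x => fine (P [set w | (x%:E < Msigma xi sigma w)%E]) / tail F x) x
     @[x --> +oo] --> fine (\int[P]_w sigma_ext sigma w) ->
  Sstar F.
Proof.
move=> xi_meas _ xi_df _ iX _ Flong adm stop sigma0 Sle0 foo Mlim.
have [C [_ tC]] := df_sum_bounded xi_meas xi_df iX.
apply: (@Sstar_of_middle R F _ Flong.1 C tC Flong) => [x y|e e0].
  exact: tail_df_anti xi_meas xi_df _ _.
apply: (tail_convolution_small xi_meas xi_df adm stop Sle0 e0 iX Flong _ foo Mlim).
(* [alive 0] is the event that [sigma] is not 0, which has positive probability. *)
rewrite -lte_fin -prE; last exact: (measurable_alive adm stop 0).
apply: lt_le_trans sigma0 _; apply: le_measure; rewrite ?inE.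
- exact: (Fn_measurable adm (Fn_sigma adm stop (leqnn 0))).

- exact: (measurable_alive adm stop 0).
by move=> w sw k; rewrite /= ltnS leqn0 => /eqP ->.
Qed.
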